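(* Let $a\in(0,1)$ and let $g\in C^1([0,1])$ be a bistable nonlinearity, i.e. $g(0)=g(a)=g(1)=0$ and there are $0<a_1<a<a_2<1$ such that $g'(u)<0$ for $u\in[0,a_1)\cup(a_2,1]$ and $g'(u)>0$ for $u\in(a_1,a_2)$. Then for every sufficiently small $d>0$ (i.e. there is $d_0>0$ depending on $g$ such that for all $d\in(0,d_0)$) the planar map $$\phi(u,v)=\left(2u-v-\tfrac1d g(u),\,u\right)$$ possesses the shift $\sigma:\Sigma_3\to\Sigma_3$ as a subsystem, i.e. there exist a set $\Lambda\subset Q=[0,1]^2$ and a homeomorphism $\tau:\Sigma_3\to\Lambda$ such that $\phi(\tau(s))=\tau(\sigma(s))$ for every $s\in\Sigma_3$.
   Context: $\Sigma_3=\{0,a,1\}^{\mathbb Z}$ is the space of biinfinite sequences $s=(s_i)_{i\in\mathbb Z}$ over the three-letter alphabet $\{0,a,1\}$ (here $0,a,1$ are regarded as three distinct symbols), with the product topology (discrete topology on the alphabet). The shift $\sigma$ is the left shift, $(\sigma(s))_i=s_{i+1}$. The map $\phi$ is regarded as a map $\mathbb R^2\to\mathbb R^2$ after extending $g$ continuously to $\mathbb R$; since $\Lambda\subset Q$, only the values of $g$ on $[0,1]$ matter for the statement. *)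

(* Defs.v *)
From HB Require Import structures.
From mathcomp Require Import all_boot all_order all_algebra.
From mathcomp Require Import all_classical all_reals all_analysis.

Set Implicit Arguments.
Unset Strict Implicit.
Unset Printing Implicit Defensive.

Import Order.TTheory GRing.Theory Num.Theory.
Import numFieldNormedType.Exports.

Local Open Scope classical_set_scope.
Local Open Scope ring_scope.

Inductive letter := letter0 | lettera | letter1.

Definition letter_code (l : letter) : option bool :=
  match l with letter0 => Some false | lettera => None | letter1 => Some true end.

Definition letter_decode (o : option bool) : letter :=
  match o with Some false => letter0 | None => lettera | Some true => letter1 end.

Lemma letter_codeK : cancel letter_code letter_decode.
Proof. by case. Qed.

HB.instance Definition _ := Choice.copy letter (can_type letter_codeK).

Definition Sigma3 : topologicalType :=
  prod_topology (fun _ : int => discrete_topology letter).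

Definition left_shift (s : Sigma3) : Sigma3 := fun i : int => s (i + 1).

Definition homeomorphism (X Y : topologicalType) (f : X -> Y) : Prop :=
  continuous f /\
  exists f' : Y -> X, [/\ cancel f f', cancel f' f & continuous f'].

Section Bistable.
Context {R : realType}.

(* [dg u] is the limit of the difference quotients of [g] taken inside [x, y],
   hence the one-sided derivative at the endpoints; the values of [g] and [dg]
   outside [x, y] play no role. *)
Definition C1_on_itv (x y : R) (g dg : R -> R) : Prop :=
  (forall u, u \in `[x, y] ->
    (g w - g u) / (w - u) @[w --> within (`[x, y] `\ u) (nbhs u)] --> dg u) /\
  {within `[x, y], continuous dg}.

Definition bistable (a : R) (g : R -> R) : Prop :=
  [/\ g 0 = 0, g a = 0, g 1 = 0 &
  exists2 dg : R -> R, C1_on_itv 0 1 g dg &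
  exists a1 a2 : R, [/\ 0 < a1 < a, a < a2 < 1,
    forall u, 0 <= u < a1 -> dg u < 0,
    forall u, a2 < u <= 1 -> dg u < 0 &
    forall u, a1 < u < a2 -> 0 < dg u]].

Definition phi (d : R) (g : R -> R) (p : R * R) : R * R :=
  (2 * p.1 - p.2 - d^-1 * g p.1, p.1).

Definition unit_square : set (R * R) := `[0, 1] `*` `[0, 1].

End Bistable.

(* Main.v *)
(* With E u = 2u - g(u)/d, a sequence u is an orbit of phi, in the sense that
   phi (u_i, u_(i-1)) = (u_(i+1), u_i), iff u_(i+1) + u_(i-1) = E (u_i).  For
   small d the term g/d dominates near each zero 0, a, 1 of g, where g' <> 0:
   on a small interval J_l of [0, 1] around the zero coded by l, E expands
   distances by a factor at least 4 and its image contains [0, 2].  So for a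
   given s the map sending u to (E|J_(s_i))^-1 (u_(i+1) + u_(i-1)) is a
   1/2-contraction for the sup norm on [0, 1]^Z, and there is exactly one orbit
   with u_i in J_(s_i) for all i.  Orbits whose codes agree at all indices at
   distance < n from i differ by at most 2^-n at i, which makes
   s |-> (u_0, u_(-1)) continuous; it is injective because (u_0, u_(-1))
   determines the orbit and the J_l are disjoint.  A continuous injection of the
   compact space Sigma3 into the plane is a homeomorphism onto its image. *)

Require Import Defs.
From HB Require Import structures.
From mathcomp Require Import all_boot all_order all_algebra.
From mathcomp Require Import all_classical all_reals all_analysis.
From mathcomp Require Import zify ring lra.

Import Order.TTheory GRing.Theory Num.Theory.
Import numFieldNormedType.Exports.

Local Open Scope classical_set_scope.
Local Open Scope ring_scope.

(** * Topology of the sequence space and of the plane *)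

Lemma compact_inj_homeomorphism (X Y : topologicalType) (f : X -> Y) :
  compact [set: X] -> hausdorff_space Y -> continuous f -> injective f ->
  exists2 tau : X -> set_type (range f), homeomorphism tau &
    forall x, set_val (tau x) = f x.
Proof.
move=> cX hY cf injf.
have fr x : f x \in range f by apply/mem_set; exists x.
pose tau x : set_type (range f) := exist _ (f x) (fr x).
have /choice[tau' tau'P] (y : set_type (range f)) : exists x, f x = set_val y.
  by case: y => y /= yr; have [x _ fx] := set_mem yr; exists x.
exists tau => //; split.
  exact: (@continuous_comp_initial _ _ _ (@set_val _ (range f)) tau).
exists tau'; split.
- by move=> x; apply: injf; rewrite tau'P.
- by move=> y; apply: val_inj; rewrite /= tau'P.
apply/continuous_closedP => C cC.
have -> : tau' @^-1` C = set_val @^-1` (f @` C).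
  apply/seteqP; split=> y /=; first by move=> Cy; exists (tau' y).
  by case=> x Cx; rewrite -tau'P => /injf <-.
apply: (continuous_closedP _).1; first exact: initial_continuous.
apply: compact_closed => //; apply: continuous_compact.
  exact: continuous_subspaceT.
exact: subclosed_compact cC cX _.
Qed.

Lemma Sigma3_compact : compact [set: Sigma3].
Proof.
have cl : compact [set: discrete_topology letter].
  apply: finite_compact.
  apply: (@sub_finite_set _ _ [set letter0; lettera; letter1] ).
    by case=> _ /=; tauto.
  by rewrite !finite_setU; repeat split; exact: finite_set1.
have := @tychonoff int (fun=> discrete_topology letter) (fun=> setT) (fun=> cl).
by congr compact; apply/seteqP; split.
Qed.

Lemma Sigma3_agree_near (s : Sigma3) (n : nat) (i : int) :
  \forall s' \near s, forall j : int, `|j - i| < n%:Z -> s j = s' j.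
Proof.
(* The window around [i] fits among the [2 * n] indices starting at [i - n], so agreement on it
   follows from finitely many open conditions, one per coordinate. *)
have : \forall s' \near s, forall t : 'I_(2 * n),
    s (i - n%:Z + t%:Z) = s' (i - n%:Z + t%:Z).
  apply: (@filter_forall Sigma3 'I_(2 * n)
    (fun t s' => s (i - n%:Z + t%:Z) = s' (i - n%:Z + t%:Z)) (nbhs s)) => t.
  set k := i - n%:Z + t%:Z.
  have := @proj_continuous int (fun=> discrete_topology letter) k s.
  move=> /(_ _ (@discrete_set1 (discrete_topology letter) (s k))).
  by move=> sk; apply: (@filterS _ (nbhs s) _ (proj k @^-1` [set s k])).
apply: filterS => s' ss' j ji.
have lt : (absz (j - i + n%:Z)%R < 2 * n)%N by lia.
have := ss' (Ordinal lt); congr (s _ = s' _) => /=; lia.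
Qed.

Lemma prod_hausdorff (X Y : topologicalType) :
  hausdorff_space X -> hausdorff_space Y -> hausdorff_space (X * Y)%type.
Proof.
move=> hX hY [x y] [x' y'] cl; congr pair.
- apply: hX => A B xA xB; have [] := cl (A `*` setT) (B `*` setT).
  + by exists (A, setT) => //; split=> //; exact: filterT.
  + by exists (B, setT) => //; split=> //; exact: filterT.
  by move=> z [[? _] [? _]]; exists z.1.
- apply: hY => A B yA yB; have [] := cl (setT `*` A) (setT `*` B).
  + by exists (setT, A) => //; split=> //; exact: filterT.
  + by exists (setT, B) => //; split=> //; exact: filterT.
  by move=> z [[_ ?] [_ ?]]; exists z.2.
Qed.

Lemma continuous_pair (X Y Z : topologicalType) (f : X -> Y) (g : X -> Z) :
  continuous f -> continuous g -> continuous (fun x => (f x, g x)).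
Proof. by move=> cf cg x; apply: cvg_pair; [exact: cf|exact: cg]. Qed.

(** * Calculus for [C1] functions on a closed interval *)

Section Differentiation.
Context {R : realType} (g dg : R -> R) (x y : R).
Context (gC1 : C1_on_itv x y g dg).

(** Near [u] the difference quotient is within 1 of [dg u], which gives a Lipschitz estimate at [u]
    with constant [|dg u| + 1]. *)
Lemma C1_on_itv_continuous : {within `[x, y], continuous g}.
Proof.
apply/subspace_continuousP => u uxy.
have /cvgrPdist_lt/(_ 1 ltr01) q1 := gC1.1 u uxy.
have lip : \forall w \near within `[x, y] (nbhs u),
    `|g u - g w| <= (`|dg u| + 1) * `|u - w|.
  move: q1; rewrite !near_withinE; apply: filterS => w /= q1 wxy.
  have [->|wu] := eqVneq w u; first by rewrite !subrr normr0 mulr0.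
  have wu0 : w - u != 0 by rewrite subr_eq0.
  have /q1 {}q1 : (`[x, y] `\ u) w by split=> //; apply/eqP.
  rewrite distrC -[g w - g u](divfK wu0) normrM [`|u - w|]distrC.
  apply: ler_wpM2r => //.
  have := ler_normD (dg u) (- (dg u - (g w - g u) / (w - u))).
  by rewrite normrN opprB addrC subrK; lra.
apply/cvgrPdist_lt => e e0; near=> w.
have -> : e = (`|dg u| + 1) * (e / (`|dg u| + 1)).
  by rewrite mulrC divfK// gt_eqF// ltr_pwDr.
have lw : `|g u - g w| <= (`|dg u| + 1) * `|u - w| by near: w.
apply: le_lt_trans lw _; rewrite ltr_pM2l ?ltr_pwDr//.
near: w; apply: cvg_within; apply: nbhsx_ballx.
by rewrite divr_gt0// ltr_pwDr.
Unshelve. all: by end_near. Qed.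

Lemma C1_on_itv_is_derive u : x < u < y -> is_derive u 1 g (dg u).
Proof.
move=> /andP[xu uy].
have uxy : u \in `[x, y] by rewrite in_itv /= !ltW.
have lim : h^-1 *: (g (h *: 1 + u) - g u) @[h --> 0^'] --> dg u.
  apply/cvgrPdist_lt => e e0.
  have /cvgrPdist_lt/(_ e e0) := gC1.1 u uxy.
  rewrite near_withinE => qe.
  have nb : \forall w \near u, w \in `[x, y].
    have : u \in `]x, y[ by rewrite in_itv /= xu.
    move=> /near_in_itvoo; apply: filterS => w.
    by rewrite !in_itv /= => /andP[? ?]; rewrite !ltW.
  rewrite near_withinE.
  have : \forall h \near (0 : R), (h + u) \in `[x, y] /\ 
     ((`[x, y] `\ u) (h + u) -> `|dg u - (g (h + u) - g u) / (h + u - u)| < e).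
    have sh : h + u @[h --> (0 : R)] --> u.
      by rewrite -[X in _ --> X]add0r; apply: cvgD; [exact: cvg_id|exact: cvg_cst].
    exact: sh _ (filterI nb qe).
  apply: filterS => h [hxy hq] h0.
  have /hq : (`[x, y] `\ u) (h + u).
    by split=> //; apply/eqP; rewrite -subr_eq0 addrK.
  by rewrite addrK /GRing.scale /= mulr1 mulrC.
apply: DeriveDef; first by apply/cvg_ex; exists (dg u).
by apply: cvg_lim lim; exact: norm_hausdorff.
Qed.

(** By the mean value theorem [g w - g v = dg z * (w - v)], and near [c] the value [dg z] differs
    from [dg c] by less than half of [|dg c|]. Multiplying by [dg c] treats both signs of the
    derivative at once. *)
Lemma C1_on_itv_expansion (c : R) : c \in `[x, y] -> dg c != 0 ->
  exists2 e, 0 < e & forall v w, v \in `[x, y] -> w \in `[x, y] ->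
    `|v - c| <= e -> `|w - c| <= e -> v <= w ->
    dg c ^+ 2 / 2 * (w - v) <= dg c * (g w - g v).
Proof.
move=> cxy dc0.
have dc2 : 0 < `|dg c| / 2 by rewrite divr_gt0 ?normr_gt0.
have /cvgrPdist_lt/(_ _ dc2) := (subspace_continuousP _ _).1 gC1.2 c cxy.
rewrite near_withinE => /nbhs_ballP[e /= e0 eP].
exists (e / 2); first by rewrite divr_gt0.
move=> v w vxy wxy vc wc; rewrite le_eqVlt => /predU1P[->|vw].
  by rewrite !subrr !mulr0.
have [x_v w_y] : x <= v /\ w <= y.
  by move: vxy wxy; rewrite !in_itv /= => /andP[? _] /andP[_ ?].
have cont : {within `[v, w], continuous g}.
  apply: continuous_subspaceW C1_on_itv_continuous.
  by apply: subset_itv; rewrite bnd_simp.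
have der z : z \in `]v, w[ -> is_derive z 1 g (dg z).
  rewrite in_itv /= => /andP[? ?]; apply: C1_on_itv_is_derive.
  by rewrite (le_lt_trans x_v)// (lt_le_trans _ w_y).
have [z] := MVT vw der cont; rewrite in_itv /= => /andP[vz zw] ->.
have zc : ball c e z by rewrite /ball /=; move: vc wc; rewrite !ler_norml ltr_norml; lra.
have zxy : z \in `[x, y] by rewrite in_itv /=; lra.
have dz := eP z zc zxy.
rewrite mulrA ler_wpM2r ?subr_ge0 ?(ltW vw)//.
have : dg c * (dg c - dg z) <= `|dg c| * (`|dg c| / 2).
  by rewrite (le_trans (ler_norm _))// normrM ler_wpM2l// ltW.
by rewrite mulrA -expr2 real_normK ?num_real//; lra.
Qed.

Lemma C1_on_itv_decreasing (c : R) : c \in `[x, y] -> dg c < 0 ->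
  exists e m, [/\ 0 < e, 0 < m & forall v w, v \in `[x, y] -> w \in `[x, y] ->
    `|v - c| <= e -> `|w - c| <= e -> v <= w -> m * (w - v) <= g v - g w].
Proof.
move=> cxy dc; have [|e e0 eP] := C1_on_itv_expansion c cxy; first by rewrite lt_eqF.
exists e, (- dg c / 2); split=> // [|v w vxy wxy vc wc vw]; first by lra.
rewrite -(@ler_pM2l _ (- dg c)) ?oppr_gt0//.
by have := eP v w vxy wxy vc wc vw; lra.
Qed.

Lemma C1_on_itv_increasing (c : R) : c \in `[x, y] -> 0 < dg c ->
  exists e m, [/\ 0 < e, 0 < m & forall v w, v \in `[x, y] -> w \in `[x, y] ->
    `|v - c| <= e -> `|w - c| <= e -> v <= w -> m * (w - v) <= g w - g v].
Proof.
move=> cxy dc; have [|e e0 eP] := C1_on_itv_expansion c cxy; first by rewrite gt_eqF.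
exists e, (dg c / 2); split=> // [|v w vxy wxy vc wc vw]; first by lra.
rewrite -(@ler_pM2l _ (dg c))//.
by have := eP v w vxy wxy vc wc vw; lra.
Qed.

End Differentiation.

(** * Estimates with powers of one half *)

Section GeometricBounds.
Context {R : realType}.

Lemma le0_geometric (x C : R) :
  (forall n, x <= C * 2^-1 ^+ n) -> x <= 0.
Proof.
move=> xC; rewrite leNgt; apply/negP => x0.
have C0 : 0 < C by have := xC 0%N; rewrite expr0 mulr1; apply: lt_le_trans.
pose n := Num.bound (C / x).
have Cn : C / x < n%:R by apply: archi_boundP; rewrite divr_ge0 ?ltW.
have n2 : n%:R < 2 ^+ n :> R by rewrite -natrX ltr_nat ltn_expl.
have : C / x < 2 ^+ n by exact: lt_trans n2.
rewrite ltr_pdivrMr// => CX.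
have := xC n; rewrite exprVn ler_pdivlMr ?exprn_gt0//; lra.
Qed.

Lemma geometric_limit (x : nat -> R) :
  (forall n, `|x n.+1 - x n| <= 2^-1 ^+ n) ->
  exists l, forall n, `|x n - l| <= 2 * 2^-1 ^+ n.
Proof.
(* The tail of the series of the [2^-1 ^+ k] from [n] on sums to [2 * 2^-1 ^+ n], so the intervals
   from [lo n] to [hi n] are nested; the supremum of the left ends lies in all of them. *)
move=> dx; pose lo n := x n - 2 * 2^-1 ^+ n; pose hi n := x n + 2 * 2^-1 ^+ n.
have pos n : 0 < 2^-1 ^+ n :> R by rewrite exprn_gt0 ?invr_gt0.
have loS k n : lo n <= lo (n + k)%N.
  elim: k => [|k IH]; first by rewrite addn0.
  apply: le_trans IH _; rewrite addnS /lo exprS.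
  by have := dx (n + k)%N; rewrite ler_norml => /andP[+ _]; lra.
have hiS k n : hi (n + k)%N <= hi n.
  elim: k => [|k IH]; first by rewrite addn0.
  apply: le_trans _ IH; rewrite addnS /hi exprS.
  by have := dx (n + k)%N; rewrite ler_norml => /andP[_ +]; lra.
have lohi m n : lo m <= hi n.
  have le1 := loS n m; have le2 := hiS m n; rewrite addnC in le2.
  by apply: le_trans le1 (le_trans _ le2); rewrite /lo /hi; have := pos (m + n)%N; lra.
have hs n : ubound (range lo) (hi n) by move=> _ [m _ <-].
have ne : range lo !=set0 by exists (lo 0%N), 0%N.
exists (sup (range lo)) => n.
have /(_ (lo n)) ub := @ub_le_sup _ (range lo) (ex_intro _ _ (hs 0%N)).
have le1 : lo n <= sup (range lo) by apply: ub; exists n.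
have le2 : sup (range lo) <= hi n by exact: ge_sup.
by rewrite ler_norml; apply/andP; split; move: le1 le2; rewrite /lo /hi; lra.
Qed.

End GeometricBounds.

(** * Orbits with a prescribed code *)

Section SymbolicCoding.
Context {R : realType} (E : R -> R) (J : letter -> set R).
Context (J01 : forall l x, J l x -> 0 <= x <= 1).
Context (J_disjoint : forall l l' x, J l x -> J l' x -> l = l').
Context (J_covers : forall l y, 0 <= y <= 2 -> exists2 x, J l x & E x = y).
Context (J_expands :
  forall l x y, J l x -> J l y -> 4 * `|x - y| <= `|E x - E y|).

Definition coded_orbit (s : Sigma3) (u : int -> R) : Prop :=
  forall i, J (s i) (u i) /\ u (i + 1) + u (i - 1) = E (u i).

(** Induction on [n]. Agreement at [i] puts both values in the same [J], where expansion bounds 4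
    times their distance by the sum of the distances at [i + 1] and [i - 1]. The windows of radius
    [n] around these neighbours lie in that of radius [n.+1] around [i], so the sum is at most
    [2 * 2^-1 ^+ n]. *)
Lemma coded_orbit_close {s s' : Sigma3} {u u' : int -> R} :
  coded_orbit s u -> coded_orbit s' u' -> forall (n : nat) (i : int),
  (forall j, `|j - i| < n%:Z -> s j = s' j) -> `|u i - u' i| <= 2^-1 ^+ n.
Proof.
move=> su su'; elim=> [|n IH] i ss'.
  have [/J01 ? _] := su i; have [/J01 ? _] := su' i.
  by rewrite expr0 ler_norml; lra.
have [Ju eu] := su i; have [Ju' eu'] := su' i.
rewrite -ss' ?subrr ?normr0// in Ju'.
have := J_expands _ _ _ Ju Ju'; rewrite -eu -eu'.
have h1 : `|u (i + 1) - u' (i + 1)| <= 2^-1 ^+ n.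
  by apply: IH => j ji; apply: ss'; lia.
have h2 : `|u (i - 1) - u' (i - 1)| <= 2^-1 ^+ n.
  by apply: IH => j ji; apply: ss'; lia.
rewrite opprD addrACA => le4; have := le_trans le4 (ler_normD _ _).
by rewrite exprS; lra.
Qed.

Lemma coded_orbit_unique {s : Sigma3} {u u' : int -> R} :
  coded_orbit s u -> coded_orbit s u' -> u =1 u'.
Proof.
move=> su su' i; apply/eqP; rewrite -subr_eq0 -normr_le0.
by apply: (@le0_geometric _ _ 1) => n; rewrite mul1r (coded_orbit_close su su').
Qed.

Lemma coded_orbit_exists (s : Sigma3) : exists u, coded_orbit s u.
Proof.
(* [h (l, y)] is the preimage of [y] under [E] in [J l]; for [y] outside [0, 2] the default 0 is
   taken. Sums of two values in [0, 1] never leave [0, 2]. *)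
have /choice[h hP] (ly : letter * R) : exists x,
    0 <= ly.2 <= 2 -> J ly.1 x /\ E x = ly.2.
  case: ly => l y /=; have [y02|_] := boolP (0 <= y <= 2); last by exists 0.
  by have [x] := J_covers l y y02; exists x.
pose F (u : int -> R) i := h (s i, u (i + 1) + u (i - 1)).
have FP u i : (forall j, 0 <= u j <= 1) ->
    J (s i) (F u i) /\ E (F u i) = u (i + 1) + u (i - 1).
  move=> u01; apply: (hP (s i, _)) => /=.
  by have := u01 (i + 1); have := u01 (i - 1); lra.
have F_contr u v i (e : R) : (forall j, 0 <= u j <= 1) ->
    (forall j, 0 <= v j <= 1) -> (forall j, `|u j - v j| <= e) ->
    `|F u i - F v i| <= e / 2.
  move=> u01 v01 uv; have [Ju eu] := FP u i u01; have [Jv ev] := FP v i v01.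
  have := J_expands _ _ _ Ju Jv; rewrite eu ev opprD addrACA => le4.
  have := le_trans le4 (ler_normD _ _).
  by have := uv (i + 1); have := uv (i - 1); lra.
(* Picard iteration. The initial sequence has to lie in [0, 1], not in the sets [J (s i)]. *)
pose x n := iter n F (fun=> 0).
have x01 n i : 0 <= x n i <= 1.
  elim: n i => [|n IH] i; first by rewrite /= lexx ler01.
  by have [/J01] := FP (x n) i IH.
have dx n i : `|x n.+1 i - x n i| <= 2^-1 ^+ n.
  elim: n i => [|n IH] i.
    by have := x01 1%N i; rewrite expr0 /x/= subr0 ler_norml; lra.
  by rewrite exprSr; exact: (F_contr (x n.+1) (x n) i _ (x01 _) (x01 _) IH).
(* The limit is taken at each index separately, but its rate does not depend on the index, so
   [F_contr] applies to [x n] and [u]. *)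
have /choice[u uP] i := geometric_limit (x ^~ i) (fun n => dx n i).
have u01 i : 0 <= u i <= 1.
  apply/andP; split; rewrite -subr_le0; apply: (@le0_geometric _ _ 2) => n;
    have := uP i n; have := x01 n i; rewrite ler_norml; lra.
(* Pass through [x n.+1 i = F (x n) i]: it is within [2^-1 ^+ n] of [u i] by the rate of
   convergence, and within [2^-1 ^+ n] of [F u i] by contraction. *)
have uF i : u i = F u i.
  apply/eqP; rewrite -subr_eq0 -normr_le0; apply: (@le0_geometric _ _ 2) => n.
  have := F_contr (x n) u i _ (x01 n) u01 (fun j => uP j n).
  have := uP i n.+1; rewrite exprS /=.
  have -> : u i - F u i = (u i - x n.+1 i) + (F (x n) i - F u i) by rewrite /=; lra.
  rewrite distrC => ? ?; apply: le_trans (ler_normD _ _) _.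
  by rewrite -[x n.+1 i]/(F (x n) i); lra.
by exists u => i; have [] := FP u i u01; rewrite -uF.
Qed.

(** Two consecutive values determine the whole orbit, as the recurrence can be solved for
    [u (i + 1)] and for [u (i - 1)]; hence both inductions carry a pair of neighbours. Disjointness
    of the [J l] then recovers each letter. *)
Lemma coded_orbit_inj {s s' : Sigma3} {u u' : int -> R} :
  coded_orbit s u -> coded_orbit s' u' ->
  u 0 = u' 0 -> u (-1) = u' (-1) -> s = s'.
Proof.
move=> su su' e0 eN1.
have fwd (n : nat) : u n%:Z = u' n%:Z /\ u (n%:Z - 1) = u' (n%:Z - 1).
  elim: n => [|n [IH1 IH2]]; first by rewrite sub0r.
  have -> : n.+1%:Z - 1 = n%:Z by lia.
  have -> : n.+1%:Z = n%:Z + 1 by lia.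
  by split=> //; have [_] := su n%:Z; have [_] := su' n%:Z; rewrite IH1 IH2; lra.
have bwd (n : nat) : u (- n%:Z) = u' (- n%:Z) /\
    u (- n%:Z - 1) = u' (- n%:Z - 1).
  elim: n => [|n [IH1 IH2]]; first by rewrite oppr0 sub0r.
  have -> : - n.+1%:Z = - n%:Z - 1 by lia.
  split=> //; have [_] := su (- n%:Z - 1); have [_] := su' (- n%:Z - 1).
  by rewrite subrK IH1 IH2; lra.
have uu' i : u i = u' i.
  by case: (intP i) => [|n|n]; [have [] := fwd 0%N|have [] := fwd n.+1|have [] := bwd n.+1].
apply: functional_extensionality_dep => i.
have [Ju _] := su i; have [Ju' _] := su' i.
by apply: (J_disjoint _ _ _ Ju); rewrite uu'.
Qed.

Lemma coded_orbit_continuous (U : Sigma3 -> int -> R) (i : int) :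
  (forall s, coded_orbit s (U s)) -> continuous (U ^~ i).
Proof.
move=> UP s.
apply: (iffRL (@cvgrPdist_le R R Sigma3 (nbhs s) _ (U ^~ i) (U s i))) => e e0.
have [n ne] : exists n, 2^-1 ^+ n <= e.
  have [//|none] := pselect (exists n, 2^-1 ^+ n <= e).
  have : e <= 0.
    apply: (@le0_geometric _ _ 1) => n; rewrite mul1r leNgt; apply/negP => ne.
    by apply: none; exists n; exact: ltW.
  by rewrite leNgt e0.
apply: (@filterS _ (nbhs s) _ _ _ _ (Sigma3_agree_near s n i)) => s' ss'.
by apply: le_trans ne; exact: (coded_orbit_close (UP s) (UP s')).
Qed.

Lemma shift_subsystem :
  exists2 Lambda : set (R * R), Lambda `<=` unit_square &
    exists2 tau : Sigma3 -> set_type Lambda, homeomorphism tau &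
      forall s : Sigma3,
        (E (set_val (tau s)).1 - (set_val (tau s)).2, (set_val (tau s)).1)
        = set_val (tau (left_shift s)).
Proof.
have /choice[U UP] := coded_orbit_exists.
pose f s := (U s 0, U s (-1)).
have f_cont : continuous f.
  by apply: continuous_pair; exact: coded_orbit_continuous.
have f_inj : injective f.
  by move=> s s' [] /(coded_orbit_inj (UP s) (UP s')); exact.
have hR2 : hausdorff_space (R * R)%type by apply: prod_hausdorff; exact: Rhausdorff.
have [tau tau_homeo tauE] :=
  compact_inj_homeomorphism _ _ f Sigma3_compact hR2 f_cont f_inj.
exists (range f).
  move=> _ [s _ <-]; have [/J01 ? _] := UP s 0; have [/J01 ? _] := UP s (-1).
  by split; rewrite /= in_itv.
exists tau => // s; rewrite !tauE /f /=.
(* The shifted orbit is coded by the shifted sequence, so by uniqueness it is the orbit chosen for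
   [left_shift s]; the recurrence at index 0 then gives the conjugacy. *)
have shiftU : coded_orbit (left_shift s) (fun i => U s (i + 1)).
  move=> i; have [Ji Ei] := UP s (i + 1).
  by split; [exact: Ji|rewrite -Ei [i - 1 + 1]addrAC].
have Ue := coded_orbit_unique (UP (left_shift s)) shiftU.
rewrite !Ue add0r addNr; congr pair.
by have [_] := UP s 0; rewrite add0r sub0r => <-; rewrite addrK.
Qed.

End SymbolicCoding.

(** * From the bistable nonlinearity to the expanding branches *)

Lemma bistable_monotone {R : realType} {a : R} {g : R -> R} :
  0 < a < 1 -> bistable a g ->
  exists e m, [/\ [/\ 0 < e < a - e, a + e < 1 - e & 0 < m],
    forall v w, 0 <= v -> v <= w -> w <= e -> m * (w - v) <= g v - g w,
    forall v w, a - e <= v -> v <= w -> w <= a + e -> m * (w - v) <= g w - g v &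
    forall v w, 1 - e <= v -> v <= w -> w <= 1 -> m * (w - v) <= g v - g w].
Proof.
move=> a01 [_ _ _ [dg gC1 [a1 [a2 [a1P a2P dg0 dg1 dga]]]]].
have [||e0 [m0 [e0p m0p H0]]] := C1_on_itv_decreasing _ _ _ _ gC1 0.
- by rewrite in_itv /= lexx ler01.
- by apply: dg0; lra.
have [||ea [ma [eap map Ha]]] := C1_on_itv_increasing _ _ _ _ gC1 a.
- by rewrite in_itv /=; lra.
- by apply: dga; lra.
have [||e1 [m1 [e1p m1p H1]]] := C1_on_itv_decreasing _ _ _ _ gC1 1.
- by rewrite in_itv /= lexx ler01.
- by apply: dg1; lra.
move=> {dg gC1 a1 a2 a1P a2P dg0 dg1 dga}.
(* The bounds [a / 3] and [(1 - a) / 3] keep the intervals around 0, [a] and 1 disjoint and inside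
   [0, 1]. *)
pose e := Num.min (Num.min e0 (Num.min ea e1)) (Num.min (a / 3) ((1 - a) / 3)).
pose m := Num.min m0 (Num.min ma m1).
have [ep ee0 eea ee1 [ea3 e1a]] : [/\ 0 < e, e <= e0, e <= ea, e <= e1 &
    e <= a / 3 /\ e <= (1 - a) / 3].
  by rewrite /e !lt_min !ge_min !lexx ?orbT; split=> //; lra.
have [mp mm0 mma mm1] : [/\ 0 < m, m <= m0, m <= ma & m <= m1].
  by rewrite /m !lt_min !ge_min !lexx ?orbT; split=> //; lra.
move: e m ep ee0 eea ee1 ea3 e1a mp mm0 mma mm1 => e m ep ee0 eea ee1 ea3 e1a mp mm0 mma mm1.
have scale (v w n D : R) : v <= w -> m <= n -> n * (w - v) <= D -> m * (w - v) <= D.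
  by move=> vw mn; apply: le_trans; rewrite ler_wpM2r ?subr_ge0.
exists e, m; split; first by split; lra.
- by move=> v w *; apply: (scale _ _ m0) => //; apply: H0 => //;
    rewrite ?in_itv /= ?ler_norml; apply/andP; split; lra.
- by move=> v w *; apply: (scale _ _ ma) => //; apply: Ha => //;
    rewrite ?in_itv /= ?ler_norml; apply/andP; split; lra.
- by move=> v w *; apply: (scale _ _ m1) => //; apply: H1 => //;
    rewrite ?in_itv /= ?ler_norml; apply/andP; split; lra.
Qed.

Theorem theorem1 (R : realType) (a : R) (g : R -> R)
    (ha : 0 < a < 1) (hg : bistable a g) :
  exists2 d0 : R, 0 < d0 &
    forall d : R, 0 < d < d0 ->
      exists2 Lambda : set (R * R), Lambda `<=` unit_square &
        exists2 tau : Sigma3 -> set_type Lambda, homeomorphism tau &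
          forall s : Sigma3,
            phi d g (set_val (tau s)) = set_val (tau (left_shift s)).
Proof.
have [e [m [[e0 e1 m0] H0 Ha H1]]] := bistable_monotone ha hg.
have [g0 ga g1 [dg gC1 _]] := hg.
(* [d < m / 6] makes [g / d] expand by at least 6, leaving 4 after the term [2 * u] is subtracted;
   [d < m * e / 2] makes [g / d] vary by more than 2 over a length [e], as covering [0, 2]
   demands. *)
exists (Num.min (m / 6) (m * e / 2)).
  by rewrite lt_min !divr_gt0 ?mulr_gt0//; case/andP: e0.
move=> d /andP[d0]; rewrite lt_min => /andP[d6 de].
pose E u := 2 * u - d^-1 * g u.
pose lo l := match l with letter0 => 0 | lettera => a - e | letter1 => 1 - e end.
pose hi l := match l with letter0 => e | lettera => a + e | letter1 => 1 end.
pose J l : set R := [set u | lo l <= u <= hi l].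
have E_cont l : {within `[lo l, hi l], continuous E}.
  have sub : `[lo l, hi l] `<=` `[0, 1].
    by apply: subset_itv; case: l; rewrite bnd_simp /=; lra.
  have gcont := continuous_subspaceW sub (C1_on_itv_continuous _ _ _ _ gC1).
  have idcont : {within `[lo l, hi l], continuous (@idfun R)}.
    by apply: continuous_subspaceT => z; exact: cvg_id.
  move=> u; apply: cvgB; first by apply: cvgM; [exact: cvg_cst|exact: idcont].
  by apply: cvgM; [exact: cvg_cst|exact: gcont].
have expand l v w : J l v -> J l w -> v <= w ->
    m * (w - v) <= `|g w - g v|.
  case: l => /= /andP[? ?] /andP[? ?] vw.
  - by rewrite distrC; apply: le_trans (ler_norm _); exact: H0.
  - by apply: le_trans (ler_norm _); exact: Ha.
  - by rewrite distrC; apply: le_trans (ler_norm _); exact: H1.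
have me2 : 2 < d^-1 * (m * e) by rewrite mulrC ltr_pdivlMr//; lra.
have dV : 0 < d^-1 by rewrite invr_gt0.
have J01 l x : J l x -> 0 <= x <= 1 by case: l => /andP[] /=; lra.
have J_disjoint l l' x : J l x -> J l' x -> l = l'.
  by case: l l' => -[]// /andP[/= ? ?] /andP[/= ? ?]; exfalso; lra.
have J_covers l y : 0 <= y <= 2 -> exists2 x, J l x & E x = y.
  move=> y02.
  have lohi : lo l <= hi l by case: l => /=; lra.
  (* By the intermediate value theorem it is enough to look at the ends. [E] is 0 at 0 and exceeds 2
     at [e]; it exceeds 2 at [a - e] and is negative at [a + e]; it is negative at [1 - e] and
     equals 2 at 1. *)
  suff mm : Num.min (E (lo l)) (E (hi l)) <= y <= Num.max (E (lo l)) (E (hi l)).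
    have [x xJ xE] := IVT lohi (E_cont l) mm.
    by exists x => //; move: xJ; rewrite in_itv.
  have scale v w : m * e <= v - w -> 2 < d^-1 * v - d^-1 * w.
    by move=> vw; rewrite -mulrBr (lt_le_trans me2)// ler_wpM2l// ltW.
  rewrite ge_min le_max /E; case: l {lohi} => /=; rewrite ?g0 ?g1.
  + have /scale : m * e <= g 0 - g e by rewrite -[X in m * X]subr0; apply: H0; lra.
    by rewrite g0; lra.
  + have /scale : m * e <= g a - g (a - e).
      have -> : m * e = m * (a - (a - e)) by ring.
      by apply: Ha; lra.
    have /scale : m * e <= g (a + e) - g a.
      have -> : m * e = m * (a + e - a) by ring.
      by apply: Ha; lra.
    by rewrite ga; lra.
  + have /scale : m * e <= g (1 - e) - g 1.
      have -> : m * e = m * (1 - (1 - e)) by ring.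
      by apply: H1; lra.
    by rewrite g1; lra.
have J_expands l v w : J l v -> J l w -> 4 * `|v - w| <= `|E v - E w|.
  wlog vw : v w / v <= w => [hwlog|] Jv Jw.
    have [|/ltW] := leP v w => vw; first exact: hwlog.
    by rewrite [`|v - w|]distrC [`|E v - E w|]distrC; exact: hwlog.
  rewrite [`|v - w|]distrC [`|E v - E w|]distrC.
  have d6V : 6 <= d^-1 * m by rewrite mulrC ler_pdivlMr//; lra.
  (* The triangle inequality applied to this identity gives
     [6 * (w - v) <= 2 * (w - v) + |E w - E v|]. *)
  have gE : d^-1 * (g w - g v) = 2 * (w - v) - (E w - E v) by rewrite /E; ring.
  have := ler_wpM2l (ltW dV) (expand _ _ _ Jv Jw vw).
  rewrite -[d^-1 in X in _ <= X](gtr0_norm dV) -normrM gE mulrA.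
  have wv0 : 0 <= w - v by rewrite subr_ge0.
  have := ler_wpM2r wv0 d6V.
  have := ler_normB (2 * (w - v)) (E w - E v).
  rewrite [`|2 * _|]ger0_norm ?mulr_ge0//.
  by rewrite (ger0_norm wv0); lra.
have [Lambda LQ [tau tau_homeo tauE]] :=
  shift_subsystem E J J01 J_disjoint J_covers J_expands.
by exists Lambda => //; exists tau => // s; rewrite -tauE /phi addrAC.
Qed.
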